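(* Let $m,g$ be positive integers and let $\mu=(\mu_1\ge\cdots\ge\mu_m\ge 0)$ be a partition contained in the rectangle with $m$ rows and $g$ columns (i.e. $\mu_1\le g$, $\ell(\mu)\le m$). Let $\hat\mu=(g-\mu_m,g-\mu_{m-1},\dots,g-\mu_1)$ be the complement of $\mu$ in this rectangle. Then there exists a crystal-weight-preserving bijection $\Psi_{m,g}$ between the set $K(\mu,m)$ of King tableaux of shape $\mu$ and the set $\mathrm{SSOT}_g(\hat\mu,m)$.
   Context: King tableaux: for an integer $m$, a King tableau of shape $\lambda$ with $\ell(\lambda)\le m$ is a filling of the Young (Ferrers) diagram of $\lambda$ with letters of the alphabet $1<\bar 1<2<\bar 2<\cdots<m<\bar m$ such that (1) entries weakly increase along rows and strictly increase down columns, and (2) all entries in row $i$ are $\ge i$. $K(\lambda,m)$ denotes the set of King tableaux of shape $\lambda$. The (crystal) weight of a King tableau is $(\alpha_1,\dots,\alpha_m)$ where $\alpha_i$ is the number of entries $i$ minus the number of entries $\bar i$. Oscillating horizontal strips: for partitions $\lambda\subset\nu$ with $|\nu|=|\lambda|+1$, let $r(\nu/\lambda)=i$ be the row of the added box and set $r(\lambda/\nu)=-i$. An oscillating horizontal strip of length $\ell\ge 0$ is a sequence of partitions $S=(\lambda_0,\dots,\lambda_\ell)$ such that consecutive partitions differ by adding or removing exactly one box, and the signed row numbers $r(\lambda_p/\lambda_{p-1})$, $p=1,\dots,\ell$, are weakly decreasing (so all additions come before all removals, additions occur in weakly decreasing rows and removals in weakly increasing rows). Write $\mathrm{inside}(S)=\lambda_0$,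 $\mathrm{outside}(S)=\lambda_\ell$, $\mathrm{size}(S)=\ell$. Semistandard oscillating tableaux: a (skew) semistandard oscillating tableau is a sequence $T=(S_1,S_2,\dots)$ of oscillating horizontal strips with $\mathrm{outside}(S_i)=\mathrm{inside}(S_{i+1})$ for all $i$ and $\mathrm{size}(S_k)=0$ for $k$ large; its weight is $(\mathrm{size}(S_1),\mathrm{size}(S_2),\dots)$; $\mathrm{outside}(T)$ is $\mathrm{outside}(S_k)$ for $k$ large. It is an SSOT if $\mathrm{inside}(S_1)=\emptyset$. $c(T)$ is the maximum number of columns of a partition occurring in $T$. $\mathrm{SSOT}_g(\nu,m)$ is the set of SSOTs $T$ with $\mathrm{outside}(T)=\nu$, weight $\alpha$ with $\alpha_i=0$ for $i>m$, and $c(T)\le g$. The crystal weight of $T\in\mathrm{SSOT}_g(\nu,m)$ with weight $\alpha$ is $(\beta_1,\dots,\beta_m)$ with $\beta_i=g-\alpha_i$. Crystal-weight-preserving means the King tableau and its image have the same crystal weight vector in $\mathbb Z^m$. *)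

(* Defs.v *)
From HB Require Import structures.
From mathcomp Require Import all_boot all_order all_algebra.
From mathcomp Require Import classical_sets functions.

Set Implicit Arguments.
Unset Strict Implicit.
Unset Printing Implicit Defensive.

Import Order.TTheory GRing.Theory Num.Theory.
Local Open Scope nat_scope.

(* A partition is the sequence of its nonzero parts, so that equality of
   partitions is equality of sequences; [nth 0 la i] is the part of row i + 1,
   and [head 0 la] is the number of columns. *)
Definition is_partition (la : seq nat) : bool :=
  sorted geq la && all (leq 1) la.

Definition ncols (la : seq nat) : nat := head 0 la.

Definition contained (la nu : seq nat) : bool :=
  all (fun i => nth 0 la i <= nth 0 nu i) (iota 0 (size la)).

(* The zero parts created by the complementation are dropped. *)
Definition complement (m g : nat) (mu : seq nat) : seq nat :=
  [seq x <- mkseq (fun i => g - nth 0 mu (m - i.+1)) m | 0 < x].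

(* The letter i is (i, false) and the letter i-bar is (i, true), in
   lexicographic order with false < true; letters i are numbered from 1. *)
Notation letter := (nat *l bool)%type.
Definition unbarred (i : nat) : letter := (i, false).
Definition barred (i : nat) : letter := (i, true).

(* A filling is given by its list of rows, from top to bottom. *)
Definition filling := seq (seq letter).

Definition entry (t : filling) (i j : nat) : letter :=
  nth (unbarred 0) (nth [::] t i) j.

Definition is_king (mu : seq nat) (m : nat) (t : filling) : Prop :=
  [/\ map size t = mu,
      forall x, x \in flatten t -> 1 <= x.1 <= m,
      forall row, row \in t -> sorted <=%O row,
      forall i j, j < size (nth [::] t i.+1) ->
        (entry t i j < entry t i.+1 j)%O
    & forall i x, x \in nth [::] t i -> (unbarred i.+1 <= x)%O].

Definition King (mu : seq nat) (m : nat) : set filling :=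
  [set t | is_king mu m t]%classic.

Definition king_weight (m : nat) (t : filling) : {ffun 'I_m -> int} :=
  [ffun i : 'I_m => (count_mem (unbarred i.+1) (flatten t))%:Z
                    - (count_mem (barred i.+1) (flatten t))%:Z]%R.

Definition covered_by (la nu : seq nat) : bool :=
  contained la nu && (sumn nu == (sumn la).+1).

Definition one_box_apart (la nu : seq nat) : bool :=
  covered_by la nu || covered_by nu la.

(* The row (numbered from 1) of the box nu / la when [covered_by la nu]. *)
Definition added_row (la nu : seq nat) : nat :=
  (find (fun i => nth 0 la i < nth 0 nu i) (iota 0 (size nu))).+1.

(* r(nu / la) for two partitions that differ by one box. *)
Definition signed_row (la nu : seq nat) : int :=
  (if covered_by la nu then (added_row la nu)%:Z
   else - (added_row nu la)%:Z)%R.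

(* The pair (la_0, [:: la_1; ...; la_l]) encodes the nonempty sequence
   la_0, ..., la_l. *)
Definition strip : Type := (seq nat * seq (seq nat))%type.

Definition partitions_of (S : strip) : seq (seq nat) := S.1 :: S.2.
Definition inside (S : strip) : seq nat := S.1.
Definition outside (S : strip) : seq nat := last S.1 S.2.
Definition strip_size (S : strip) : nat := size S.2.

Definition is_osc_strip (S : strip) : bool :=
  [&& all is_partition (partitions_of S),
      path one_box_apart S.1 S.2
    & sorted (fun x y : int => (y <= x)%R) (pairmap signed_row S.1 S.2)].

(* The k-th strip S_k of an oscillating tableau is [T k.-1]. *)
Definition strips := nat -> strip.

Definition is_skew_ssot (T : strips) : Prop :=
  [/\ forall k, is_osc_strip (T k),
      forall k, outside (T k) = inside (T k.+1)
    & exists n, forall k, n <= k -> strip_size (T k) = 0].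

Definition is_ssot (T : strips) : Prop :=
  is_skew_ssot T /\ inside (T 0) = [::].

Definition ssot_outside (T : strips) (nu : seq nat) : Prop :=
  exists n, forall k, n <= k -> outside (T k) = nu.

Definition occurs (T : strips) (la : seq nat) : Prop :=
  exists k, la \in partitions_of (T k).

(* [is_max_cols T c] says that c(T) = c. *)
Definition is_max_cols (T : strips) (c : nat) : Prop :=
  (exists2 la, occurs T la & ncols la = c) /\
  (forall la, occurs T la -> ncols la <= c).

Definition SSOT (g : nat) (nu : seq nat) (m : nat) : set strips :=
  [set T | [/\ is_ssot T,
               ssot_outside T nu,
               forall k, m <= k -> strip_size (T k) = 0
             & exists2 c, is_max_cols T c & c <= g]]%classic.

Definition ssot_weight (g m : nat) (T : strips) : {ffun 'I_m -> int} :=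
  [ffun k : 'I_m => g%:Z - (strip_size (T k))%:Z]%R.

(* Main.v *)
(* Let [F (2k)] and [F (2k+1)] be the shapes formed by the letters at most k,
   respectively at most k-bar, of a King tableau: they increase by horizontal
   strips and have at most k rows.  Complementing each of them in the rectangle
   with k rows and g columns gives partitions [L c] such that [L (2k)] contains
   both [L (2k-1)] and [L (2k+1)], each time by a horizontal strip.  An
   oscillating horizontal strip from [L (2k-1)] to [L (2k+1)] with largest
   partition [L (2k)] exists exactly under this condition, and it is unique
   because its signed row numbers are sorted and their multiplicities are
   determined by the three partitions. *)

Require Import Defs.
From HB Require Import structures.
From mathcomp Require Import all_boot all_order all_algebra.
From mathcomp Require Import boolp classical_sets functions zify.

Set Implicit Arguments.
Unset Strict Implicit.
Unset Printing Implicit Defensive.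

Import Order.TTheory.
Local Open Scope nat_scope.

(** * Partitions *)

Lemma part_nth_le (la : seq nat) (i j : nat) :
  is_partition la -> i <= j -> nth 0 la j <= nth 0 la i.
Proof.
case/andP=> srt _ le_ij; have [le_s | lt_j] := leqP (size la) j.
  by rewrite nth_default.
have geq_trans : transitive geq by move=> a b c /= h1 h2; apply: leq_trans h2 h1.
have := sorted_leq_nth geq_trans (fun x => leqnn x) 0 srt.
by move=> /(_ i j); apply; rewrite ?inE //; apply: leq_ltn_trans lt_j.
Qed.

Lemma part_nth_gt0 (la : seq nat) (i : nat) :
  is_partition la -> (0 < nth 0 la i) = (i < size la).
Proof.
case/andP=> _ /all_nthP pos; have [lt_i | le_i] := ltnP i (size la).
  exact: pos.
by rewrite nth_default.
Qed.

Lemma part_ext (la nu : seq nat) :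
  is_partition la -> is_partition nu -> nth 0 la =1 nth 0 nu -> la = nu.
Proof.
move=> pla pnu eq_nth; apply: (@eq_from_nth _ 0) => //.
have E i : (i < size la) = (i < size nu).
  by rewrite -(part_nth_gt0 i pla) -(part_nth_gt0 i pnu) eq_nth.
by have := E (size la); have := E (size nu); lia.
Qed.

Definition trim (n : nat) (f : nat -> nat) : seq nat :=
  [seq x <- mkseq f n | 0 < x].

(** The zeros of a weakly decreasing function come last, so dropping them shifts no row. *)
Lemma nth_trim (n : nat) (f : nat -> nat) :
  (forall i, f i.+1 <= f i) -> (forall i, n <= i -> f i = 0) ->
  nth 0 (trim n f) =1 f.
Proof.
elim: n f => [|n IHn] f f_dec f0 i; first by rewrite nth_nil f0.
have shift : mkseq f n.+1 = f 0 :: mkseq (fun i => f i.+1) n.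
  by rewrite /mkseq -[iota 0 n.+1]/(0 :: iota 1 n) /= (iotaDl 1 0 n) -map_comp.
have IH := IHn (fun i => f i.+1) (fun i => f_dec i.+1) (fun i => f0 i.+1).
rewrite /trim shift /= -/(trim n (fun i => f i.+1)).
case: ltnP => [_|f00]; first by case: i => [//|i]; apply: IH.
have fz j : f j = 0 by elim: j => [|j IHj]; [lia | have := f_dec j; lia].
by rewrite IH !fz.
Qed.

Lemma trim_partition (n : nat) (f : nat -> nat) :
  (forall i, f i.+1 <= f i) -> (forall i, n <= i -> f i = 0) ->
  is_partition (trim n f).
Proof.
move=> f_dec f0; apply/andP; split; last exact: filter_all.
by apply/(sortedP 0) => i _; rewrite /= !nth_trim.
Qed.

Lemma sumn_nth (la : seq nat) (n : nat) :
  size la <= n -> sumn la = \sum_(i < n) nth 0 la i.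
Proof.
elim: la n => [|x la IHla] [|n] //= h.
- by rewrite big_ord0.
- by rewrite big1 // => i _; rewrite nth_nil.
- by rewrite big_ord_recl /= (IHla n).
Qed.

(** * Adding and removing one box *)

Lemma containedP (la nu : seq nat) :
  reflect (forall i, nth 0 la i <= nth 0 nu i) (contained la nu).
Proof.
apply: (iffP allP) => [h i|h i _]; last exact: h.
have [lt_i | ge_i] := ltnP i (size la); last by rewrite nth_default.
by apply: h; rewrite mem_iota.
Qed.

(* [moves r la nu]: the signed row [r], that is [Posz j.+1] for an addition and
   [Negz j] for a removal in the row of index [j], leads from [la] to [nu]. *)
Definition moves (r : int) (la nu : nat -> nat) : Prop :=
  forall j, nu j + (r == Negz j) = la j + (r == Posz j.+1).

Lemma covered_byP (la nu : seq nat) (i : nat) :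
  (forall j, nth 0 nu j = nth 0 la j + (j == i)) ->
  covered_by la nu /\ added_row la nu = i.+1.
Proof.
move=> h; have le_i : i < size nu.
  by rewrite ltnNge; apply/negP => /(nth_default 0); have := h i; rewrite eqxx; lia.
split.
  apply/andP; split; first by apply/containedP => j; rewrite h leq_addr.
  rewrite (sumn_nth (leq_maxl (size la) (size nu))).
  rewrite (sumn_nth (leq_maxr (size la) (size nu))).
  under eq_bigr do rewrite h.
  have lt_i : i < maxn (size la) (size nu) by rewrite leq_max le_i orbT.
  rewrite big_split /= (bigD1 (Ordinal lt_i)) //= [X in _ + X](bigD1 (Ordinal lt_i)) //=.
  rewrite eqxx [X in _ + (_ + X)]big1 ?addn0 ?addn1 // => j.
  by rewrite -val_eqE /= => /negPf ->.
congr S; rewrite (eq_find (a2 := pred1 i)); last first.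
  by move=> j /=; rewrite h -[X in X < _]addn0 ltn_add2l; case: eqP.
have := @index_uniq _ 0 i (iota 0 (size nu)).
by rewrite size_iota nth_iota // iota_uniq /index; apply.
Qed.

(** The row differences are nonnegative and sum to 1, so the row found by [added_row] accounts for
    all of them. *)
Lemma covered_byE (la nu : seq nat) :
  covered_by la nu ->
  forall j, nth 0 nu j = nth 0 la j + (j.+1 == added_row la nu).
Proof.
case/andP=> /containedP le_ln /eqP eq_s.
set n := maxn (size la) (size nu).
have sl := sumn_nth (leq_maxl (size la) (size nu)).
have sn := sumn_nth (leq_maxr (size la) (size nu)).
rewrite -/n in sl sn.
set a := fun i => nth 0 la i < nth 0 nu i.
have has_a : has a (iota 0 (size nu)).
  apply: contraT => /hasPn nh; suff : sumn nu <= sumn la by rewrite eq_s ltnn.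
  rewrite sl sn; apply: leq_sum => j _; have [lj | gj] := ltnP j (size nu).
    by have := nh j; rewrite mem_iota /a => /(_ lj); lia.
  by rewrite nth_default.
rewrite /added_row -/a; set k := find a _ => j; rewrite eqSS.
have lt_k : k < size nu by move: has_a; rewrite has_find size_iota.
have := nth_find 0 has_a; rewrite -/k nth_iota // add0n => ak.
have kn : k < n by rewrite leq_max lt_k orbT.
have : \sum_(i < n) (nth 0 nu i - nth 0 la i) = 1.
  by rewrite sumnB // -sl -sn eq_s subSnn.
rewrite (bigD1 (Ordinal kn)) //= => sum1.
have : \sum_(i < n | i != Ordinal kn) (nth 0 nu i - nth 0 la i) = 0.
  by move: ak sum1; rewrite /a /=; move: (\sum_(i < n | _) _) => sm; lia.
move/eqP; rewrite sum_nat_eq0 => /forallP all0.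
case: (eqVneq j k) => [-> | njk]; first by move: ak; rewrite /a /=; lia.
have [ltj | gej] := ltnP j n.
  have := all0 (Ordinal ltj); rewrite -val_eqE /= njk /= => /eqP.
  by have := le_ln j; lia.
move: gej; rewrite geq_max => /andP[h1 h2].
by rewrite !nth_default.
Qed.

Lemma signed_row_moves (la nu : seq nat) :
  one_box_apart la nu ->
  [/\ signed_row la nu != 0%R
    & moves (signed_row la nu) (nth 0 la) (nth 0 nu)].
Proof.
rewrite /one_box_apart /signed_row; case: ifP => [c _ | _ /= c]; split=> // j.
  by rewrite (covered_byE c) addn0 /added_row eqz_nat [in RHS]eq_sym.
by rewrite (covered_byE c) addn0 /added_row /= eqSS eq_sym.
Qed.

Lemma moves_signed_row (r : int) (la nu : seq nat) :
  r != 0%R -> moves r (nth 0 la) (nth 0 nu) ->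
  one_box_apart la nu /\ signed_row la nu = r.
Proof.
case: r => [[//|i] | i] _ mv.
  have [] := @covered_byP la nu i; last first.
    by move=> c e; rewrite /one_box_apart /signed_row c e.
  by move=> j; have := mv j; rewrite /= addn0 => ->; rewrite eqz_nat eqSS eq_sym.
have [] := @covered_byP nu la i; last first.
  (* [signed_row] tests for an addition first; comparing the sums of parts rules it out here. *)
  move=> c e; rewrite /one_box_apart /signed_row c orbT e; case: ifP => //.
  case/andP: c => [_ /eqP c] /andP[_ /eqP]; lia.
by move=> j; have := mv j; rewrite /= addn0 => <-; congr (_ + _); rewrite eq_sym.
Qed.

Lemma moves_inj (r : int) (la nu nu' : seq nat) :
  is_partition nu -> is_partition nu' ->
  moves r (nth 0 la) (nth 0 nu) -> moves r (nth 0 la) (nth 0 nu') -> nu = nu'.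
Proof.
by move=> p p' m m'; apply: part_ext => // j; have := m j; have := m' j; lia.
Qed.

(** * Oscillating horizontal strips *)

Definition srows (S : strip) : seq int := pairmap signed_row S.1 S.2.

(* The row lengths of the largest partition of [S], reached after the last
   addition. *)
Definition top (S : strip) (j : nat) : nat :=
  nth 0 (inside S) j + count_mem (Posz j.+1) (srows S).

Lemma count_mem_gt (r x : int) (s : seq int) :
  all (fun y => (y <= r)%R) s -> (r < x)%R -> count_mem x s = 0.
Proof.
move=> /allP le_r lt_rx; apply/count_memPn/negP => /le_r.
by rewrite leNgt lt_rx.
Qed.

Lemma ge_int_trans : transitive (fun x y : int => (y <= x)%R).
Proof. by move=> a b c h1 h2; exact: le_trans h2 h1. Qed.

Lemma is_osc_strip_cons (la nu : seq nat) (s : seq (seq nat)) :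
  is_osc_strip (la, nu :: s) =
  [&& is_partition la, one_box_apart la nu, is_osc_strip (nu, s)
    & all (fun y => (y <= signed_row la nu)%R) (srows (nu, s))].
Proof.
rewrite /is_osc_strip /= (path_sortedE ge_int_trans).
by case: (is_partition la); rewrite //= -!andbA; do !bool_congr.
Qed.

(** Induction from the front. Sortedness confines the later moves: after an addition in row [i] no
    lower row grows, and after a removal nothing is added and no higher row shrinks. So an
    interlacing inequality not given by induction reduces to the decrease of the rows of [la]. *)
Lemma strip_shape (S : strip) : is_osc_strip S ->
  [/\ all (fun r => r != 0%R) (srows S),
      forall j, nth 0 (outside S) j + count_mem (Negz j) (srows S) = top S j,
      forall j, top S j.+1 <= nth 0 (inside S) j,
      forall j, top S j.+1 <= nth 0 (outside S) j
    & (exists2 la, la \in partitions_of S & nth 0 la =1 top S) /\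
      forall la, la \in partitions_of S -> forall j, nth 0 la j <= top S j].
Proof.
case: S => la s; elim: s la => [|nu s IHs] la.
  rewrite /is_osc_strip /= => /andP[/andP[pla _] _].
  have le_la j : nth 0 la j.+1 <= nth 0 la j by exact: part_nth_le.
  split=> // [j|j|]; rewrite /top /outside /inside /= ?addn0 //.
  split; last by move=> ? /[!inE] /eqP -> j; rewrite addn0.
  by exists la; rewrite ?inE // => j; rewrite addn0.
rewrite is_osc_strip_cons => /and4P[pla apart Snu le_r].
have [nz bal in_top out_top [[ka ka_in ka_top] le_top]] := IHs nu Snu.
have [r_nz mv] := signed_row_moves apart.
have topE j : top (la, nu :: s) j = top (nu, s) j + (signed_row la nu == Negz j).
  by have := mv j; rewrite /top /inside /srows /=; lia.
have pla_le j : nth 0 la j.+1 <= nth 0 la j by exact: part_nth_le.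
have bal' j : nth 0 (outside (la, nu :: s)) j +
    count_mem (Negz j) (srows (la, nu :: s)) = top (la, nu :: s) j.
  by rewrite topE -bal /outside /srows /=; lia.
have out_eq : outside (la, nu :: s) = outside (nu, s) by [].
have in_eq : inside (la, nu :: s) = la by [].
have le_la j : nth 0 la j <= top (la, nu :: s) j by rewrite leq_addr.
have mem_cons l : (l \in partitions_of (la, nu :: s)) =
    (l == la) || (l \in partitions_of (nu, s)) by rewrite inE.
split=> //.
- by rewrite /srows /= r_nz.
- move=> j; rewrite topE in_eq.
  move: r_nz mv le_r topE; case: (signed_row la nu) => [[//|i]|i] _ mv le_r topE.
    have /= := mv j; have /= := mv j.+1; rewrite !addn0.
    have := in_top j; rewrite /inside /=.
    (* After an addition in row [j], no addition reaches row [j.+1], which keeps its length in [la]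
       up to the top. *)
    case: (eqVneq j i) => [eq_ji|ne_ji].
      have -> : top (nu, s) j.+1 = nth 0 nu j.+1.
        by rewrite /top (count_mem_gt le_r) ?addn0 // eq_ji ltz_nat.
      have := pla_le j; rewrite eq_ji eqz_nat; lia.
    by rewrite !eqz_nat; lia.
  (* A removal comes first, so no addition follows and the rest of the strip has top [nu]. *)
  have top0 k : top (nu, s) k = nth 0 nu k.
    by rewrite /top (count_mem_gt le_r) ?addn0.
  have := mv j.+1; have := mv j; have := pla_le j; rewrite top0 /=; lia.
- move=> j; rewrite topE out_eq.
  move: r_nz mv le_r topE; case: (signed_row la nu) => [[//|i]|i] _ mv le_r topE.
    by rewrite addn0.
  have top0 k : top (nu, s) k = nth 0 nu k.
    by rewrite /top (count_mem_gt le_r) ?addn0.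
  (* Removals go down the diagram: if row [j.+1] loses the first box, row [j] never loses one. *)
  case: (eqVneq i j.+1) => [eq_ij | ne_ij]; last first.
    by rewrite -[Negz i == _]/(i == j.+1) (negPf ne_ij) addn0.
  have := bal j; rewrite (count_mem_gt le_r); last first.
    by rewrite eq_ij -[(_ < _)%R]/(j < j.+1).
  have := mv j.+1; have := mv j; have := pla_le j; rewrite !top0 eq_ij eqxx.
  by rewrite -[Negz j.+1 == Negz j]/(j.+1 == j) /=; lia.
- split; last first.
    move=> l; rewrite mem_cons => /orP[/eqP -> //|lin] j.
    by rewrite topE; apply: leq_trans (le_top _ lin j) (leq_addr _ _).
  move: r_nz mv le_r topE; case: (signed_row la nu) => [[//|i]|i] _ mv le_r topE.
    by exists ka; rewrite ?mem_cons ?ka_in ?orbT // => j; rewrite topE addn0.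
  exists la; first by rewrite mem_cons eqxx.
  move=> j; rewrite topE /top (count_mem_gt le_r) // addn0.
  by have := mv j; rewrite /= addn0 => <-.
Qed.

(** Each nonzero signed row is counted by exactly one of the terms. *)
Lemma size_signed_rows (s : seq int) (n : nat) :
  all (fun r => r != 0%R) s ->
  (forall j, n <= j -> count_mem (Posz j.+1) s = 0 /\ count_mem (Negz j) s = 0) ->
  size s = \sum_(j < n) (count_mem (Posz j.+1) s + count_mem (Negz j) s).
Proof.
elim: s => [|r s IHs] /= => [_ _|/andP[r_nz nz] small]; first by rewrite big1.
rewrite IHs // => [|j /small [/eqP + /eqP]]; last first.
  by rewrite !addn_eq0 => /andP[_ /eqP -> ] /andP[_ /eqP ->].
under [RHS]eq_bigr do rewrite addnACA.
rewrite [RHS]big_split /= -[LHS]add1n; congr (_ + _).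
have [i ri] : exists i, forall j, (r == Posz j.+1) + (r == Negz j) = (j == i).
  case: r r_nz {small} => [[//|i]|i] _; exists i => j.
    by rewrite eqz_nat eqSS addn0 eq_sym.
  by rewrite add0n eq_sym.
have lt_i : i < n.
  by rewrite ltnNge; apply/negP => /small; have := ri i; rewrite eqxx; lia.
rewrite (bigD1 (Ordinal lt_i)) //= ri eqxx big1 // => j.
by rewrite -val_eqE /= ri => /negPf ->.
Qed.

(** The strip makes |top| - |inside| additions and |top| - |outside| removals; the identity avoids
    subtraction. *)
Lemma strip_sizeE (S : strip) (n : nat) :
  is_osc_strip S -> (forall j, n <= j -> top S j = 0) ->
  strip_size S + \sum_(j < n) nth 0 (inside S) j + \sum_(j < n) nth 0 (outside S) j
    = (\sum_(j < n) top S j).*2.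
Proof.
move=> oS top0; have [nz bal _ _ _] := strip_shape oS.
have -> : strip_size S = size (srows S) by rewrite size_pairmap.
rewrite (@size_signed_rows _ n) //; last first.
  by move=> j /top0 t0; have := bal j; move: t0; rewrite /top; lia.
rewrite -!big_split -addnn -big_split; apply: eq_bigr => j _ /=.
have := bal j; rewrite /top.
by move: (count_mem (Posz _) _) (count_mem (Negz _) _) => a b; lia.
Qed.

(** * Strips with prescribed ends and top *)

Lemma ltn_sum_ord (n i : nat) (f h : nat -> nat) :
  i < n -> (forall j, f j <= h j) -> f i < h i ->
  \sum_(j < n) f j < \sum_(j < n) h j.
Proof.
move=> lt_i le_fh lt_fh; rewrite (bigD1 (Ordinal lt_i)) //=.
rewrite [X in _ < X](bigD1 (Ordinal lt_i)) //= -addSn leq_add //.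
by apply: leq_sum.
Qed.

(** Greedy construction in the order that sortedness forces: additions from the lowest deficient row
    upwards, then removals from the highest excessive row downwards. Interlacing keeps every
    intermediate shape a partition. *)
Lemma strip_exists (la nu : seq nat) (ka : nat -> nat) :
  is_partition la -> is_partition nu ->
  (forall j, nth 0 la j <= ka j) -> (forall j, nth 0 nu j <= ka j) ->
  (forall j, ka j.+1 <= nth 0 la j) -> (forall j, ka j.+1 <= nth 0 nu j) ->
  exists S, [/\ is_osc_strip S, inside S = la, outside S = nu & top S =1 ka].
Proof.
(* By interlacing [ka] has at most one row more than [la]. The bound [n] is then detached from [la],
   which changes during the induction. *)
move=> pla pnu le_la le_nu ka_la ka_nu; set n := (size la).+1.
have : forall j, n <= j -> ka j = 0.
  by case=> // j lj; have := ka_la j; rewrite nth_default //; lia.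
move: n => n ka0.
(* The induction is on the number of moves still to be made. *)
have [N] := ubnP (\sum_(j < n) (ka j - nth 0 la j + (ka j - nth 0 nu j))).
elim: N la ka pla le_la le_nu ka_la ka_nu ka0 => // N IHN la ka.
move=> pla le_la le_nu ka_la ka_nu ka0 ltN.
(* [r] is the first move of the strip, [la'] the partition it leads to, and
   [ka'] the largest partition of what remains. *)
have extend r la' ka' : is_partition la' -> r != 0%R ->
    moves r (nth 0 la) (nth 0 la') ->
    (forall j, ka j = ka' j + (r == Negz j)) ->
    (forall j, nth 0 la' j <= ka' j) -> (forall j, nth 0 nu j <= ka' j) ->
    (forall j, ka' j.+1 <= nth 0 la' j) -> (forall j, ka' j.+1 <= nth 0 nu j) ->
    (forall j, nth 0 la' j < ka' j -> (Posz j.+1 <= r)%R) ->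
    (forall j, nth 0 nu j < ka' j -> (Negz j <= r)%R) ->
    exists S, [/\ is_osc_strip S, inside S = la, outside S = nu & top S =1 ka].
  move=> pla' r_nz mv ka'E le_la' le_nu' ka_la' ka_nu' le_up le_down.
  have [i ri] : exists i, forall j, (r == Posz j.+1) + (r == Negz j) = (j == i).
    case: r r_nz {mv ka'E le_up le_down} => [[//|i]|i] _; exists i => j.
      by rewrite eqz_nat eqSS addn0 eq_sym.
    by rewrite add0n eq_sym.
  have lt_i : i < n.
    rewrite ltnNge; apply/negP => /ka0; have := ka'E i; have := ri i.
    by have := mv i; have := le_la' i; have := le_la i; rewrite eqxx; lia.
  have [||S [oS inS outS topS]] := IHN la' ka' pla' le_la' le_nu' ka_la' ka_nu'.
  - by move=> j /ka0; rewrite ka'E; lia.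
  - rewrite ltnS in ltN; apply: leq_trans ltN.
    apply: (ltn_sum_ord (f := fun j => ka' j - nth 0 la' j + (ka' j - nth 0 nu j))
       (h := fun j => ka j - nth 0 la j + (ka j - nth 0 nu j)) lt_i) => [j|].
      by have := mv j; have := ka'E j; have := ri j; have := le_la' j; lia.
    have := mv i; have := ka'E i; have := ri i; have := le_la' i; have := le_nu' i.
    by rewrite eqxx; lia.
  have [apart rE] := moves_signed_row r_nz mv.
  case: S oS inS outS topS => l s oS; rewrite /inside /= => El outS topS; subst l.
  have [nz bal _ _ _] := strip_shape oS.
  exists (la, la' :: s); split=> //.
    (* A later addition in a row shows that [la'] is below [ka'] there, a later removal that [nu]
       is; [le_up] and [le_down] then compare its signed row with [r]. *)
    rewrite is_osc_strip_cons pla apart oS rE; apply/allP => x xs.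
    have xgt0 : 0 < count_mem x (srows (la', s)) by rewrite -has_count has_pred1.
    case: x xs xgt0 => [[|j]|j] xs xgt0.
    - by move/allP: nz => /(_ _ xs).
    - by apply: le_up; rewrite -topS /top /inside -[X in X < _]addn0 ltn_add2l.
    - by apply: le_down; rewrite -topS -bal outS -[X in X < _]addn0 ltn_add2l.
  move=> j; rewrite ka'E -topS /top /srows /inside /= rE.
  by have := mv j; lia.
have la_dec j : nth 0 la j.+1 <= nth 0 la j by exact: part_nth_le.
(* While some row is short of [ka], the lowest such row [i] gets a box and [ka] is kept. The result
   is a partition because [ka i] is at most the length of the row above. *)
have [/existsP ex_up | ] := boolP [exists j : 'I_n, nth 0 la j < ka j].
  have ex : exists j, nth 0 la j < ka j by case: ex_up => j; exists j.
  have bnd j : nth 0 la j < ka j -> j <= n.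
    by move=> lt_j; case: (leqP j n) => // /ltnW /ka0; lia.
  case: (ex_maxnP ex bnd) => i lt_i max_i.
  pose f j := nth 0 la j + (j == i).
  have f_dec j : f j.+1 <= f j.
    rewrite /f; have := ka_la j; have := la_dec j.
    by case: (eqVneq j.+1 i) => [->|]; lia.
  have f0 j : (maxn (size la) i.+1) <= j -> f j = 0.
    by rewrite geq_max /f => /andP[lj ij]; rewrite nth_default //; lia.
  have nf := nth_trim f_dec f0.
  apply: (extend (Posz i.+1) (trim _ f) ka (trim_partition f_dec f0)) => //.
  - by move=> j; rewrite nf /f /= addn0 eqz_nat eqSS [i == j]eq_sym.
  - by move=> j; rewrite addn0.
  - by move=> j; rewrite nf /f; have := le_la j; case: eqVneq => [->|]; lia.
  - by move=> j; rewrite nf /f; have := ka_la j; lia.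
  - move=> j; rewrite nf /f lez_nat ltnS => h; apply: max_i; lia.
rewrite negb_exists => /forallP no_up.
have ka_eq j : ka j = nth 0 la j.
  case: (ltnP j n) => [lt_j|/ka0]; last by have := le_la j; lia.
  by have := no_up (Ordinal lt_j); have := le_la j; rewrite /=; lia.
(* Now [ka] is [la] and only removals remain. The highest row [i] exceeding [nu] loses a box, and
   the top of the rest shrinks with it. *)
have [/existsP ex_dn | ] := boolP [exists j : 'I_n, nth 0 nu j < ka j].
  have ex : exists j, nth 0 nu j < ka j by case: ex_dn => j; exists j.
  case: (ex_minnP ex) => i lt_i min_i.
  pose f j := nth 0 la j - (j == i).
  (* Row [i] is longer than [nu] there, which is at least [ka i.+1], the length of the row below. *)
  have f_dec j : f j.+1 <= f j.
    rewrite /f; have := ka_nu j; have := la_dec j; have := ka_eq j.+1; have := ka_eq j.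
    by case: (eqVneq j i) => [->|]; lia.
  have f0 j : size la <= j -> f j = 0 by move=> lj; rewrite /f nth_default.
  have nf := nth_trim f_dec f0.
  apply: (extend (Negz i) (trim _ f) f (trim_partition f_dec f0)) => //.
  - move=> j; rewrite nf /f addn0 -[Negz i == _]/(i == j) [i == j]eq_sym.
    by case: eqVneq => [->|]; have := ka_eq i; lia.
  - move=> j; rewrite ka_eq /f -[Negz i == _]/(i == j) [i == j]eq_sym.
    by case: eqVneq => [->|]; have := ka_eq i; lia.
  - by move=> j; rewrite nf.
  - by move=> j; have := le_nu j; rewrite /f -ka_eq; case: eqVneq => [->|]; lia.
  - by move=> j; rewrite nf.
  - by move=> j; have := ka_nu j; rewrite /f -ka_eq; lia.
  - by move=> j; rewrite nf ltnn.
  - by move=> j h; apply: min_i; move: h; rewrite /f -ka_eq; lia.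
rewrite negb_exists => /forallP no_dn.
exists (la, [::]); split=> //; last by move=> j; rewrite ka_eq /top addn0.
  by rewrite /is_osc_strip /= pla.
apply: part_ext => // j; rewrite -ka_eq; case: (ltnP j n) => [lt_j|/ka0].
  by have := no_dn (Ordinal lt_j); have := le_nu j; rewrite /=; lia.
by have := le_nu j; lia.
Qed.

(** The signed rows agree, being sorted lists with equal multiplicities. Replaying them from the
    inner partition recovers the whole strip. *)
Lemma strip_unique (S S' : strip) :
  is_osc_strip S -> is_osc_strip S' -> inside S = inside S' ->
  outside S = outside S' -> top S =1 top S' -> S = S'.
Proof.
move=> oS oS' in_eq out_eq top_eq.
have [nz bal _ _ _] := strip_shape oS.
have [nz' bal' _ _ _] := strip_shape oS'.
have rows_eq : srows S = srows S'.
  apply: (sorted_eq ge_int_trans).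
  - by move=> x y h; apply: le_anti; rewrite andbC.
  - by case/and3P: oS.
  - by case/and3P: oS'.
  apply/allP => x _; apply/eqP; case: x => [[|j]|j].
  - have cnt0 s : all (fun r : int => r != 0%R) s -> count_mem 0%R s = 0.
      by move=> /allP nz0; apply/count_memPn/negP => /nz0; rewrite eqxx.
    by rewrite !cnt0.
  - by have := top_eq j; rewrite /top in_eq; lia.
  - by have := top_eq j; rewrite -bal -bal' out_eq; lia.
case: S S' oS oS' in_eq rows_eq {out_eq top_eq nz nz' bal bal'} => la s [la' s'].
rewrite /inside /srows /= => + + eq_la; rewrite -{}eq_la.
elim: s s' la => [|nu s IHs] [|nu' s'] la //.
rewrite !is_osc_strip_cons => /and4P[_ ap oS _] /and4P[_ ap' oS' _] /= [r_eq rows_eq].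
have nu_eq : nu' = nu.
  have [_ mv] := signed_row_moves ap; have [_ mv'] := signed_row_moves ap'.
  rewrite -r_eq in mv'; apply: moves_inj mv' mv; first by case/and3P: oS' => /andP[].
  by case/and3P: oS => /andP[].
subst nu'; by case: (IHs s' nu oS oS' rows_eq) => ->.
Qed.

(** * King tableaux *)

(** An order embedding of the letters into the naturals; the letters of a King tableau get the codes
    2 to [m.*2.+1], which also index the levels below. *)
Definition code (x : letter) : nat := x.1.*2 + x.2.

Definition decode (c : nat) : letter := (c./2, odd c).

Lemma decodeK : cancel decode code.
Proof. by move=> c; rewrite /code /= addnC odd_double_half. Qed.

Lemma codeK : cancel code decode.
Proof.
by case=> a b; rewrite /code /decode /= addnC half_bit_double oddD odd_double addbF oddb.
Qed.

Lemma le_code (x y : letter) : (x <= y)%O = (code x <= code y).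
Proof.
by case: x y => [a []] [a' []];
  rewrite lexi_pair !leEnat ?leEbool /code /=; apply/idP/idP; lia.
Qed.

Lemma lt_code (x y : letter) : (x < y)%O = (code x < code y).
Proof. by rewrite ltNge le_code -ltnNge. Qed.

Definition king_shape (t : filling) (c i : nat) : nat :=
  count (fun x => code x <= c) (nth [::] t i).

(** Symplectic Gelfand-Tsetlin patterns: the first clause is the King condition, the other two say
    that levels grow by horizontal strips. Together these two also make the rows of each level
    decrease. *)
Definition is_pattern (F : nat -> nat -> nat) : Prop :=
  [/\ forall c i, c./2 <= i -> F c i = 0,
      forall c i, F c i <= F c.+1 i
    & forall c i, F c.+1 i.+1 <= F c i].

(** In a sorted sequence the entries at most [c] form an initial segment. *)
Lemma sorted_nth_leq (s : seq nat) (c j : nat) :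
  sorted leq s -> j < size s -> (nth 0 s j <= c) = (j < count (leq^~ c) s).
Proof.
elim: s j => //= x s IHs j srt lt_j.
have [le_xc | lt_cx] := leqP x c.
  by case: j lt_j => [|j] lt_j //=; rewrite IHs // (path_sorted srt).
have le_x : all (leq x) s by apply: order_path_min srt; exact: leq_trans.
have -> : count (leq^~ c) s = 0.
  apply/eqP; rewrite -leqn0 leqNgt -has_count; apply/hasPn => y /(allP le_x).
  by rewrite -ltnNge; apply: leq_trans.
case: j lt_j => [|j] /= lt_j; first by rewrite leqNgt lt_cx.
by rewrite leqNgt (leq_trans lt_cx (allP le_x _ (mem_nth 0 lt_j))).
Qed.

Lemma count_ltn_iota (n p : nat) : count (ltn^~ n) (iota 0 p) = minn n p.
Proof.
elim: p => [|p IHp]; first by rewrite minn0.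
by rewrite -addn1 iotaD count_cat IHp /= add0n; lia.
Qed.

Lemma count_flatten_ord (T : Type) (P : pred T) (t : seq (seq T)) (n : nat) :
  size t <= n -> count P (flatten t) = \sum_(i < n) count P (nth [::] t i).
Proof.
move=> le_n; rewrite count_flatten (@sumn_nth _ n) ?size_map //.
apply: eq_bigr => i _; have [lt_i | ge_i] := ltnP i (size t).
  by rewrite (nth_map [::]).
by rewrite !nth_default ?size_map.
Qed.

Lemma king_size (m : nat) (mu : seq nat) (t : filling) (i : nat) :
  is_king mu m t -> size (nth [::] t i) = nth 0 mu i.
Proof.
case=> <- _ _ _ _; have [lt_i | ge_i] := ltnP i (size t).
  by rewrite (nth_map [::]).
by rewrite !nth_default ?size_map.
Qed.

Lemma king_row_mem (t : filling) (i : nat) (x : letter) :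
  x \in nth [::] t i -> x \in flatten t.
Proof.
move=> xt; apply/flattenP; exists (nth [::] t i) => //.
by apply: mem_nth; rewrite ltnNge; apply: contraL xt => /(nth_default [::]) ->.
Qed.

Lemma king_entry_le (m : nat) (mu : seq nat) (t : filling) (c i j : nat) :
  is_king mu m t -> j < nth 0 mu i ->
  (code (entry t i j) <= c) = (j < king_shape t c i).
Proof.
move=> kt lt_j; have [szt _ srt _ _] := kt; have sz := king_size i kt.
have -> : code (entry t i j) = nth 0 (map code (nth [::] t i)) j.
  by rewrite (nth_map (unbarred 0)) // sz.
rewrite sorted_nth_leq ?size_map ?sz ?count_map //.
rewrite sorted_map (eq_sorted (e' := <=%O)); last by move=> x y; rewrite /= -le_code.
apply: srt; apply: mem_nth; rewrite ltnNge; apply/negP => /(nth_default [::]) nil.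
by move: sz lt_j; rewrite nil /= => <-.
Qed.

Lemma king_entry_code (m : nat) (mu : seq nat) (t : filling) (i j : nat) :
  is_king mu m t -> j < nth 0 mu i -> code (entry t i j) <= m.*2.+1.
Proof.
move=> kt lt_j; have [_ rng _ _ _] := kt.
have /king_row_mem/rng : entry t i j \in nth [::] t i.
  by apply: mem_nth; rewrite (king_size i kt).
by rewrite /code; case: (entry t i j) => a [] /=; lia.
Qed.

Lemma king_shape_pattern (m : nat) (mu : seq nat) (t : filling) :
  is_partition mu -> is_king mu m t -> is_pattern (king_shape t).
Proof.
move=> mu_part kt; have [_ _ _ cols low] := kt; split=> c i.
- move=> le_ci; apply/eqP; rewrite -leqn0 leqNgt -has_count; apply/hasPn => x xi.
  by have := low i x xi; rewrite le_code -ltnNge /code /=; lia.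
- by apply: sub_count => x /= /leqW.
(* Column [j] is the first of row [i] beyond level [c]. If the box below had code at most [c.+1],
   column strictness would place the box of row [i] in level [c]. *)
- rewrite leqNgt; apply/negP; set j := king_shape t c i => lt_j.
  have lt_mu : j < nth 0 mu i.+1.
    by rewrite -(king_size _ kt); apply: leq_trans lt_j (count_size _ _).
  have lt_mu' : j < nth 0 mu i by apply: leq_trans lt_mu (part_nth_le mu_part _).
  have := cols i j; rewrite (king_size _ kt) lt_code => /(_ lt_mu).
  move: lt_j; rewrite -(king_entry_le _ kt lt_mu) => le1 lt2.
  have : code (entry t i j) <= c by lia.
  by rewrite (king_entry_le _ kt lt_mu') ltnn.
Qed.

Lemma king_shape_top (m : nat) (mu : seq nat) (t : filling) (i : nat) :
  is_king mu m t -> king_shape t m.*2.+1 i = nth 0 mu i.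
Proof.
move=> kt; rewrite -(king_size i kt); apply/eqP; rewrite -all_count.
apply/(all_nthP (unbarred 0)) => j; rewrite (king_size i kt).
exact: king_entry_code.
Qed.

(** The code of an entry is the first level at which its box occurs. *)
Lemma king_shape_inj (m : nat) (mu : seq nat) (t t' : filling) :
  is_king mu m t -> is_king mu m t' ->
  (forall c i, c <= m.*2.+1 -> king_shape t c i = king_shape t' c i) -> t = t'.
Proof.
move=> kt kt' eq_sh; have [sz _ _ _ _] := kt; have [sz' _ _ _ _] := kt'.
apply: (@eq_from_nth _ [::]); first by rewrite -(size_map size t) sz -sz' size_map.
move=> i _; apply: (@eq_from_nth _ (unbarred 0));
  rewrite (king_size i kt) ?(king_size i kt') // => j lt_j.
apply: (can_inj codeK); apply/eqP.
have le_e c : c <= m.*2.+1 -> (code (nth (unbarred 0) (nth [::] t i) j) <= c) =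
    (code (nth (unbarred 0) (nth [::] t' i) j) <= c).
  move=> le_c; rewrite -!/(entry _ _ _).
  by rewrite (king_entry_le _ kt lt_j) (king_entry_le _ kt' lt_j) eq_sh.
rewrite eqn_leq le_e; last exact: king_entry_code kt' lt_j.
rewrite leqnn -le_e; [exact: leqnn | exact: king_entry_code kt lt_j].
Qed.

Lemma king_exists (m : nat) (mu : seq nat) (F : nat -> nat -> nat) :
  is_partition mu -> is_pattern F -> (forall i, F m.*2.+1 i = nth 0 mu i) ->
  exists2 t, is_king mu m t &
    forall c i, c <= m.*2.+1 -> king_shape t c i = F c i.
Proof.
move=> mu_part [F0 F_incr F_strip] F_top.
have F_mono c c' i : c <= c' -> F c i <= F c' i.
  by move=> /subnK <-; elim: (c' - c) => // n /leq_trans; apply; rewrite addSn.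
(* Each box receives the first level containing it; the search may stop at [m.*2.+1], where the
   shape is all of [mu]. *)
pose cd i j := find (fun c => j < F c i) (iota 0 m.*2.+2).
have cd_le i j c : j < nth 0 mu i -> c <= m.*2.+1 -> (cd i j <= c) = (j < F c i).
  move=> lt_j le_c.
  have has_c : has (fun c => j < F c i) (iota 0 m.*2.+2).
    by apply/hasP; exists m.*2.+1; rewrite ?mem_iota ?F_top //= ltnSn.
  have lt_cd : cd i j < m.*2.+2 by move: has_c; rewrite has_find size_iota.
  apply/idP/idP => [le_cd|].
    have := nth_find 0 has_c; rewrite -/(cd i j) nth_iota // add0n => h.
    exact: leq_trans h (F_mono _ _ _ le_cd).
  apply: contraLR; rewrite -ltnNge => lt_c.
  by have := before_find 0 lt_c; rewrite nth_iota // add0n => ->.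
have cd_max i j : j < nth 0 mu i -> cd i j <= m.*2.+1.
  by move=> lt_j; rewrite cd_le // F_top.
have cd_lt i j : j < nth 0 mu i -> j < F (cd i j) i.
  by move=> lt_j; rewrite -cd_le ?cd_max.
(* Row [i] is empty before level [i.+1.*2], whence the King condition. *)
have cd_gt i j : j < nth 0 mu i -> i.+1.*2 <= cd i j.
  move=> lt_j; rewrite leqNgt; apply/negP => lt_cd.
  by have := cd_lt i j lt_j; rewrite F0 //; lia.
pose row i := mkseq (fun j => decode (cd i j)) (nth 0 mu i).
pose t := mkseq row (size mu).
have nth_t i : nth [::] t i = row i.
  have [lt_i | ge_i] := ltnP i (size mu); first by rewrite nth_mkseq.
  by rewrite /row !nth_default ?size_mkseq.
have entryE i j : j < nth 0 mu i -> code (entry t i j) = cd i j.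
  by move=> lt_j; rewrite /entry nth_t nth_mkseq // decodeK.
have row_mem i x : x \in row i -> exists2 j, j < nth 0 mu i & x = decode (cd i j).
  by case/mapP=> j; rewrite mem_iota => lt_j ->; exists j.
exists t.
  split.
  - rewrite /t /mkseq -map_comp -[RHS](mkseq_nth 0); apply: eq_map => i /=.
    by rewrite size_mkseq.
  - move=> x /flattenP[_ /mapP[i _ ->]] /row_mem [j lt_j ->].
    by have := cd_gt i j lt_j; have := cd_max i j lt_j; rewrite /=; lia.
  - move=> _ /mapP[i _ ->]; apply/(sortedP (unbarred 0)) => j; rewrite size_mkseq => lt_j.
    rewrite !nth_mkseq //; last exact: ltnW.
    rewrite le_code !decodeK cd_le ?cd_max //; last exact: ltnW.
    by apply: ltn_trans (cd_lt _ _ lt_j).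
  - move=> i j; rewrite nth_t size_mkseq lt_code => lt_j.
    have lt_j' : j < nth 0 mu i by apply: leq_trans lt_j (part_nth_le mu_part _).
    (* If the lower box enters at level [c.+1], then [F_strip] puts the upper one in level [c]. *)
    rewrite !entryE //; have := cd_lt _ _ lt_j; have := cd_max _ _ lt_j.
    have := cd_gt _ _ lt_j; case: (cd i.+1 j) => // c _ le_c lt_F.
    by rewrite ltnS cd_le ?(ltnW le_c) //; apply: leq_trans lt_F (F_strip _ _).
  - move=> i x; rewrite nth_t => /row_mem[j lt_j ->].
    by rewrite le_code decodeK /code /= addn0 cd_gt.
move=> c i le_c; rewrite /king_shape nth_t count_map.
rewrite (@eq_in_count _ _ (ltn^~ (F c i))); last first.
  by move=> j; rewrite mem_iota /= add0n => lt_j; rewrite decodeK cd_le.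
by rewrite count_ltn_iota -F_top; apply/minn_idPl/F_mono.
Qed.

Lemma king_shape_letter (m : nat) (mu : seq nat) (t : filling) (c : nat) :
  size mu <= m -> is_king mu m t ->
  count_mem (decode c.+1) (flatten t) + \sum_(i < m) king_shape t c i
    = \sum_(i < m) king_shape t c.+1 i.
Proof.
move=> mu_rows [sz _ _ _ _]; have le_m : size t <= m by rewrite -(size_map size t) sz.
rewrite (count_flatten_ord _ le_m) -big_split; apply: eq_bigr => i _ /=.
rewrite /king_shape -count_predUI [X in _ + X](@eq_count _ _ pred0) ?count_pred0 ?addn0.
  apply: eq_count => x /=; rewrite [in RHS]leq_eqVlt ltnS; congr (_ || _).
  by rewrite -(can_eq codeK) decodeK.
by move=> x /=; apply/negbTE/negP => /andP[/eqP ->]; rewrite decodeK ltnn.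
Qed.

(** * Complementation and oscillating tableaux *)

(* Complementation, at each level [c], in the rectangle with [c./2] rows and
   [g] columns. *)
Definition flip (g : nat) (F : nat -> nat -> nat) (c i : nat) : nat :=
  if i < c./2 then g - F c (c./2.-1 - i) else 0.

(* The shapes of an oscillating tableau: at an odd level [k.*2.+1] the inner
   partition of the strip of index [k], at an even level [k.*2.+2] the largest
   partition of that strip. *)
Definition levels (T : strips) (c : nat) : nat -> nat :=
  if odd c then nth 0 (inside (T c./2)) else top (T c./2.-1).

Lemma levels_odd (T : strips) (k : nat) :
  levels T k.*2.+1 = nth 0 (inside (T k)).
Proof. by rewrite /levels /= odd_double uphalf_double. Qed.

Lemma levels_even (T : strips) (k : nat) : levels T k.*2.+2 = top (T k).
Proof. by rewrite /levels /= odd_double doubleK. Qed.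

(** What [flip] makes of a pattern. Level 0 is excluded because [levels T 0] is by default
    [top (T 0)], which need not be empty. *)
Definition is_osc_pattern (g : nat) (L : nat -> nat -> nat) : Prop :=
  [/\ forall c i, 0 < c -> c./2 <= i -> L c i = 0,
      forall c i, 0 < c -> L c i <= g,
      forall k i, L k.*2.+1 i <= L k.*2.+2 i /\ L k.*2.+2 i.+1 <= L k.*2.+1 i
    & forall k i, L k.*2.+3 i <= L k.*2.+2 i /\ L k.*2.+2 i.+1 <= L k.*2.+3 i].

Lemma flipK (g : nat) (F : nat -> nat -> nat) (c i : nat) :
  (forall i, c./2 <= i -> F c i = 0) -> (forall i, F c i <= g) ->
  flip g (flip g F) c i = F c i.
Proof.
move=> F0 Fg; rewrite /flip; case: ltnP => [lt_i|/F0 //].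
rewrite ifT; last by lia.
by rewrite subKn //; congr F; lia.
Qed.

Lemma flip_leq (g : nat) (F : nat -> nat -> nat) (c i : nat) : flip g F c i <= g.
Proof. by rewrite /flip; case: ifP => // _; apply: leq_subr. Qed.

Lemma sum_flip (g m c : nat) (F : nat -> nat -> nat) :
  c./2 <= m -> (forall i, c./2 <= i -> F c i = 0) -> (forall i, F c i <= g) ->
  \sum_(i < m) flip g F c i + \sum_(i < m) F c i = g * c./2.
Proof.
move=> le_m F0 Fg.
have cut H : (forall i, c./2 <= i -> H i = 0) ->
    \sum_(i < m) H i = \sum_(i < c./2) H i.
  move=> H0; rewrite (big_ord_widen m H le_m) [RHS]big_mkcond /=.
  by apply: eq_bigr => i _; case: ltnP => // /H0.
rewrite !cut //; last by move=> i; rewrite /flip ltnNge => ->.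
rewrite [X in _ + X](reindex_inj rev_ord_inj) -big_split /=.
rewrite (eq_bigr (fun _ => g)) => [|i _]; first by rewrite sum_nat_const card_ord mulnC.
rewrite /flip ltn_ord (_ : c./2.-1 - i = c./2 - i.+1); last by lia.
by rewrite subnK.
Qed.

Lemma parity_ind (P : nat -> Prop) :
  (forall k, P k.*2) -> (forall k, P k.*2.+1) -> forall c, P c.
Proof.
by move=> P0 P1 c; rewrite -(odd_double_half c); case: (odd c); rewrite ?add1n ?add0n.
Qed.

(** From an even level to the next odd one the rectangle is unchanged, so complementation reverses
    the inclusion and interlacing stays interlacing. From an odd level to the next even one the
    rectangle gains a row; the reflection shifts by one, and inclusion and interlacing trade
    places. *)
Lemma flip_osc_pattern (g : nat) (L : nat -> nat -> nat) :
  is_osc_pattern g L -> is_pattern (flip g L).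
Proof.
move=> [L0 Lg up down]; split=> c i.
- by rewrite /flip ltnNge => ->.
- elim/parity_ind: c => [[|k]|k]; rewrite /flip ?doubleS /= ?uphalf_double ?doubleK //.
    by case: ltnP => // lt_i; apply: leq_sub2l; have [] := down k (k - i).
  have [lt_i|] := ltnP i k => //.
  rewrite ltnS (ltnW lt_i); apply: leq_sub2l.
  by have [_] := up k (k.-1 - i); rewrite (_ : (k.-1 - i).+1 = k - i); last by lia.
- elim/parity_ind: c => [[|k]|k]; rewrite /flip ?doubleS /= ?uphalf_double ?doubleK //.
    case: ltnP => // lt_i; rewrite ifT; last by lia.
    apply: leq_sub2l; have [_] := down k (k - i.+1).
    by rewrite (_ : (k - i.+1).+1 = k - i) //; lia.
  rewrite ltnS; case: ltnP => // lt_i; apply: leq_sub2l.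
  by have [] := up k (k.-1 - i); rewrite (_ : k.-1 - i = k - i.+1) //; lia.
Qed.

Lemma flip_pattern (g : nat) (F : nat -> nat -> nat) :
  is_pattern F -> (forall c i, F c i <= g) -> is_osc_pattern g (flip g F).
Proof.
move=> [F0 incr strip] Fg; split=> [c i _|c i _|k i|k i].
- by rewrite /flip ltnNge => ->.
- exact: flip_leq.
- rewrite /flip /= ?uphalf_double ?doubleK; split.
    have [lt_i|//] := ltnP i k; rewrite ltnS (ltnW lt_i); apply: leq_sub2l.
    by have := strip k.*2.+1 (k.-1 - i); rewrite (_ : (k.-1 - i).+1 = k - i) //; lia.
  rewrite ltnS; have [lt_i|//] := ltnP i k; apply: leq_sub2l.
  by have := incr k.*2.+1 (k.-1 - i); rewrite (_ : k.-1 - i = k - i.+1) //; lia.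
- rewrite /flip /= ?uphalf_double ?doubleK; split.
    by case: ltnP => // lt_i; apply: leq_sub2l; apply: incr.
  rewrite ltnS; have [lt_i|//] := ltnP i k; rewrite ltnS (ltnW lt_i); apply: leq_sub2l.
  by have := strip k.*2.+2 (k - i.+1); rewrite (_ : (k - i.+1).+1 = k - i) //; lia.
Qed.

(** * Oscillating tableaux and their levels *)

Lemma ssot_stable (g m : nat) (nu : seq nat) (T : strips) (k : nat) :
  SSOT g nu m T -> m <= k -> T k = (nu, [::]).
Proof.
case=> [[[_ link _] _] [n out] small _] le_k.
have nil j : m <= j -> T j = (inside (T j), [::]).
  by move=> /small; rewrite /strip_size /inside; case: (T j) => l [].
have const d : inside (T (k + d)) = inside (T k).
  elim: d => [|d <-]; first by rewrite addn0.
  by rewrite addnS -link (nil (k + d)) // (leq_trans le_k) ?leq_addr.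
have := out (k + n) (leq_addl _ _); rewrite (nil (k + n)).
  by rewrite /outside /= const => <-; apply: nil.
by rewrite (leq_trans le_k) ?leq_addr.
Qed.

Lemma ssot_levels (g m : nat) (nu : seq nat) (T : strips) :
  SSOT g nu m T ->
  is_osc_pattern g (levels T) /\ levels T m.*2.+1 =1 nth 0 nu.
Proof.
move=> sT; have [[[osc link _] in0] _ _ [b [_ le_b] le_bg]] := sT.
split; last by move=> i; rewrite levels_odd (ssot_stable sT).
have part k : is_partition (inside (T k)) by case/and3P: (osc k) => /andP[].
have up k i : levels T k.*2.+1 i <= levels T k.*2.+2 i /\
    levels T k.*2.+2 i.+1 <= levels T k.*2.+1 i.
  rewrite levels_odd levels_even; split; first exact: leq_addr.
  by have [_ _ ->] := strip_shape (osc k).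
have down k i : levels T k.*2.+3 i <= levels T k.*2.+2 i /\
    levels T k.*2.+2 i.+1 <= levels T k.*2.+3 i.
  rewrite -doubleS levels_odd levels_even -link.
  by have [_ <- _ -> _] := strip_shape (osc k); split=> //; apply: leq_addr.
have cols l : occurs T l -> forall i, is_partition l -> nth 0 l i <= g.
  move=> /le_b le_l i pl; apply: leq_trans (part_nth_le pl (leq0n i)) _.
  by rewrite nth0; apply: leq_trans le_l le_bg.
split=> //.
(* Level 1 is empty, a step down creates no row, and by interlacing a step up creates at most
   one. *)
- elim=> [|c IHc] i // _; elim/parity_ind: c IHc => [[|k]|k] IHc.
  + by rewrite (levels_odd T 0) in0 nth_nil.
  + move: IHc; rewrite doubleS /= doubleK uphalf_double => IHc lt_i.
    by have [+ _] := down k i; rewrite (IHc i isT lt_i) leqn0 => /eqP.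
  + move: IHc; rewrite /= uphalf_double doubleK => IHc.
    case: i => // i lt_i; have [_] := up k i; rewrite IHc //.
    by rewrite leqn0 => /eqP.
(* The column bound reaches even levels because the top of a strip is one of its partitions. *)
- elim/parity_ind => [[//|k]|k] i _.
    rewrite doubleS levels_even; have [_ _ _ _ [[l l_in l_top] _]] := strip_shape (osc k).
    rewrite -l_top; apply: cols; first by exists k.
    by case/and3P: (osc k) => /allP + _ _; apply.
  by rewrite levels_odd; apply: cols => //; exists k; apply: mem_head.
Qed.

Lemma max_cols_exists (T : strips) (g : nat) :
  (forall la, occurs T la -> ncols la <= g) ->
  exists2 c, is_max_cols T c & c <= g.
Proof.
move=> le_g; pose P := [pred c | `[< exists2 la, occurs T la & ncols la = c >]].
have exP : exists c, P c.
  exists (ncols (inside (T 0))); apply/asboolP; exists (inside (T 0)) => //.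
  by exists 0; apply: mem_head.
have bnd c : P c -> c <= g by move/asboolP => [la occ <-]; apply: le_g.
case: (ex_maxnP exP bnd) => c Pc max_c; exists c; last exact: bnd.
split; first exact/asboolP.
by move=> la occ; apply: max_c; apply/asboolP; exists la.
Qed.

(** Odd levels give the partitions between strips and even levels the tops required by
    [strip_exists]. Agreement stops at [m.*2.+1] because [T] is stationary from index [m] on. *)
Lemma ssot_exists (g m : nat) (nu : seq nat) (L : nat -> nat -> nat) :
  is_partition nu -> is_osc_pattern g L -> L m.*2.+1 =1 nth 0 nu ->
  exists2 T, SSOT g nu m T &
    forall c i, 0 < c -> c <= m.*2.+1 -> levels T c i = L c i.
Proof.
move=> pnu [L0 Lg up down] Lnu; pose la k := trim k (L k.*2.+1).
(* Both rows are compared with row [i.+1] of the next even level. *)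
have L_dec k i : L k.*2.+1 i.+1 <= L k.*2.+1 i.
  by have [le1 _] := up k i.+1; have [_ le2] := up k i; apply: leq_trans le1 le2.
have Lz k i : k <= i -> L k.*2.+1 i = 0.
  by move=> le_i; apply: L0; rewrite //= uphalf_double.
have nth_la k : nth 0 (la k) =1 L k.*2.+1 := nth_trim (L_dec k) (Lz k).
have pla k : is_partition (la k) := trim_partition (L_dec k) (Lz k).
have nu_la : la m = nu by apply: part_ext => // i; rewrite nth_la Lnu.
have /choice[S SP] k : exists S, [/\ is_osc_strip S, inside S = la k,
    outside S = la k.+1 & top S =1 L k.*2.+2].
  apply: strip_exists => // j; rewrite nth_la ?doubleS.
  - by have [] := up k j.
  - by have [] := down k j.
  - by have [] := up k j.
  - by have [] := down k j.
pose T k := if k < m then S k else (la m, [::]).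
have inT k : k <= m -> inside (T k) = la k.
  rewrite leq_eqVlt /T => /orP[/eqP ->|lt_k]; first by rewrite ltnn.
  by rewrite lt_k; have [] := SP k.
have oscT k : is_osc_strip (T k).
  by rewrite /T; case: ifP => _; [have [] := SP k | rewrite /is_osc_strip /= pla].
have topT k i : top (T k) i <= g.
  rewrite /T; case: ifP => _; first by have [_ _ _ ->] := SP k; apply: Lg.
  by rewrite /top addn0 nth_la Lg.
have smallT k : m <= k -> strip_size (T k) = 0 by rewrite /T ltnNge => ->.
exists T; last first.
  elim/parity_ind => [[//|k]|k] i _.
    rewrite doubleS levels_even !ltnS => lt_k; rewrite /T ifT; last by lia.
    by have [_ _ _ ->] := SP k.
  by rewrite levels_odd ltnS leq_double => /inT ->; rewrite nth_la.
split.
- split; last by rewrite inT.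
  split=> // [k|]; last by exists m.
  have [lt_k | le_k] := ltnP k m; last by rewrite /T !ltnNge le_k (leqW le_k).
  by rewrite inT // {1}/T lt_k; have [] := SP k.
- by exists m => k; rewrite /T ltnNge => ->.
- exact: smallT.
- apply: max_cols_exists => l [k l_in]; rewrite /ncols -nth0.
  by have [_ _ _ _ [_ le_top]] := strip_shape (oscT k);
  apply: leq_trans (le_top _ l_in 0) _.
Qed.

Lemma ssot_levels_inj (g m : nat) (nu : seq nat) (T T' : strips) :
  SSOT g nu m T -> SSOT g nu m T' ->
  (forall c i, 0 < c -> c <= m.*2.+1 -> levels T c i = levels T' c i) -> T = T'.
Proof.
move=> sT sT' eq_lev; apply: funext => k.
have [lt_k | le_k] := ltnP k m; last by rewrite (ssot_stable sT) ?(ssot_stable sT').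
have [[[osc link _] _] _ _ _] := sT; have [[[osc' link' _] _] _ _ _] := sT'.
have in_eq j : j <= m -> inside (T j) = inside (T' j).
  move=> le_j; apply: part_ext => [||i].
  - by case/and3P: (osc j) => /andP[].
  - by case/and3P: (osc' j) => /andP[].
  by rewrite -!levels_odd eq_lev // ltnS leq_double.
apply: strip_unique => //.
- by apply: in_eq; apply: ltnW.
- by rewrite link link' in_eq.
- by move=> i; rewrite -!levels_even eq_lev //; lia.
Qed.

(* With [F] the shapes of [t] and [L] those of [T], the weight of [t] at k is
   [2 |F (2k)| - |F (2k-1)| - |F (2k+1)|], the k-th strip of [T] has size
   [2 |L (2k)| - |L (2k-1)| - |L (2k+1)|], and [|F c| + |L c| = g * c./2]. *)
Lemma weight_eq (g m : nat) (mu nu : seq nat) (t : filling) (T : strips) :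
  is_partition mu -> size mu <= m -> ncols mu <= g -> is_king mu m t ->
  SSOT g nu m T ->
  (forall c i, 0 < c -> c <= m.*2.+1 -> levels T c i = flip g (king_shape t) c i) ->
  ssot_weight g m T = king_weight m t.
Proof.
move=> pmu mu_rows mu_cols kt sT lev_eq; apply/ffunP => [[k lt_k]]; rewrite !ffunE /=.
have [[[osc link _] _] _ _ _] := sT.
have [[L0 _ _ _] _] := ssot_levels sT.
have [F0 _ _] := king_shape_pattern pmu kt.
have Fg c i : king_shape t c i <= g.
  apply: leq_trans (leq_trans (part_nth_le pmu (leq0n i)) _); last first.
    by rewrite nth0; exact: mu_cols.
  by rewrite -(king_size i kt); apply: count_size.
have sumL c : 0 < c -> c <= m.*2.+1 ->
    \sum_(i < m) levels T c i + \sum_(i < m) king_shape t c i = g * c./2.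
  move=> c0 le_c; have le_m : c./2 <= m.
    by have := half_leq le_c; rewrite /= uphalf_double.
  rewrite -(sum_flip le_m (F0 c) (Fg c)).
  by congr (_ + _); apply: eq_bigr => i _; apply: lev_eq.
have top0 j : m <= j -> top (T k) j = 0.
  move=> le_j; rewrite -levels_even L0 //= doubleK; exact: leq_trans lt_k le_j.
have := strip_sizeE (osc k) top0.
rewrite link -!levels_odd -levels_even doubleS.
have := sumL k.*2.+1; have := sumL k.*2.+2; have := sumL k.*2.+3.
have := king_shape_letter k.*2.+1 mu_rows kt.
have := king_shape_letter k.*2.+2 mu_rows kt.
rewrite /decode /= odd_double /= uphalf_double doubleK -/(unbarred k.+1) -/(barred k.+1).
move: (count_mem _ _) (count_mem _ _) (strip_size _) => a b s.
move: (\sum_(i < m) levels T k.*2.+1 i) (\sum_(i < m) levels T k.*2.+2 i)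
  (\sum_(i < m) levels T k.*2.+3 i) => l1 l2 l3.
move: (\sum_(i < m) king_shape t k.*2.+1 i) (\sum_(i < m) king_shape t k.*2.+2 i)
  (\sum_(i < m) king_shape t k.*2.+3 i) => f1 f2 f3.
(* The three rectangles have areas [g * k], [g * k + g] and [g * k + g]; twice the second minus the
   other two leaves the [g] of the crystal weight. *)
rewrite mulnS => ef3 ef2 e3 e2 e1.
have {}e1 := e1 isT ltac:(lia); have {}e2 := e2 isT ltac:(lia).
have {}e3 := e3 isT ltac:(lia).
by move: (g * k) e1 e2 e3 => gk; lia.
Qed.

Theorem theorem4p1 (m g : nat) (mu : seq nat)
    (hm : 0 < m) (hg : 0 < g)
    (mu_part : is_partition mu) (mu_rows : size mu <= m)
    (mu_cols : ncols mu <= g) :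
  exists Psi : filling -> strips,
    set_bij (King mu m) (SSOT g (complement m g mu) m) Psi /\
    (forall t, King mu m t -> ssot_weight g m (Psi t) = king_weight m t).
Proof.
set nu := complement m g mu.
have le_g i : nth 0 mu i <= g.
  by apply: leq_trans (part_nth_le mu_part (leq0n i)) _; rewrite nth0.
(* The complement before its zeros are dropped, made total so that [nth_trim] applies. *)
pose f i := if i < m then g - nth 0 mu (m - i.+1) else 0.
have nuE : nu = trim m f.
  by congr filter; apply/eq_in_map => i; rewrite mem_iota /f /= add0n => ->.
have f_dec i : f i.+1 <= f i.
  rewrite /f; case: ltnP => // lt_i; rewrite (ltnW lt_i) leq_sub2l // part_nth_le //; lia.
have f0 i : m <= i -> f i = 0 by rewrite /f ltnNge => ->.
have nu_part : is_partition nu by rewrite nuE trim_partition.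
have nth_nu : nth 0 nu =1 f by rewrite nuE; apply: nth_trim.
pose R t T := forall c i, 0 < c -> c <= m.*2.+1 ->
  levels T c i = flip g (king_shape t) c i.
have Fg t c i : King mu m t -> king_shape t c i <= g.
  move=> kt; apply: leq_trans (le_g i); rewrite -(king_size i kt); exact: count_size.
have F0 t c i : King mu m t -> c./2 <= i -> king_shape t c i = 0.
  by move=> kt; have [+ _ _] := king_shape_pattern mu_part kt; apply.
have RK t T c i : King mu m t -> R t T -> c <= m.*2.+1 ->
    king_shape t c i = flip g (levels T) c i.
  move=> kt RtT le_c; rewrite -(flipK i (fun j => F0 t c j kt) (fun j => Fg t c j kt)).
  (* [R] says nothing at level 0, where both flips vanish. *)
  case: c le_c => // c le_c.
  by rewrite {1 3}/flip; case: ifP => // _; rewrite RtT.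
have to_ssot t : exists T, King mu m t -> SSOT g nu m T /\ R t T.
  (* Off the King tableaux the value of [Psi] is arbitrary. *)
  have [kt | nkt] := pselect (King mu m t); last by exists (fun _ => ([::], [::])).
  have pat := flip_pattern (king_shape_pattern mu_part kt) (fun c i => Fg t c i kt).
  have [|T sT RtT] := @ssot_exists g m nu _ nu_part pat; last by exists T.
  move=> i; rewrite nth_nu /flip /f /= uphalf_double; case: ifP => // lt_i.
  by rewrite (king_shape_top _ kt) (_ : m.-1 - i = m - i.+1) //; lia.
have [Psi PsiP] := choice to_ssot; exists Psi; split; last first.
  by move=> t kt; have [sT Rt] := PsiP t kt;
    exact: (weight_eq mu_part mu_rows mu_cols kt sT Rt).
split.
- by move=> t kt; have [] := PsiP t kt.
- move=> t t' /set_mem kt /set_mem kt' eq_Psi.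
  (* By [RK] the levels of the image determine the shapes of the tableau. *)
  have [_ Rt] := PsiP t kt; have [_ Rt'] := PsiP t' kt'.
  apply: (king_shape_inj kt kt') => c i le_c.
  by rewrite (RK _ _ _ _ kt Rt) // (RK _ _ _ _ kt' Rt') // eq_Psi.
- move=> T sT; have [osc_pat top_lev] := ssot_levels sT.
  (* Complementing the levels of [T] back gives a pattern ending in [mu], and [t] is its tableau. *)
  have [|t kt tE] := king_exists mu_part (flip_osc_pattern osc_pat) (m := m).
    move=> i; rewrite /flip /= uphalf_double; case: ifP => [lt_i|ge_i].
      rewrite top_lev nth_nu /f ifT; last by lia.
      by rewrite subKn // (_ : m - (m.-1 - i).+1 = i) //; lia.
    by rewrite nth_default // (leq_trans mu_rows) // leqNgt ge_i.
  exists t => //; have [sT' Rt] := PsiP t kt.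
  apply: (ssot_levels_inj sT' sT) => c i c0 le_c; rewrite Rt //.
  have [L0 Lg _ _] := osc_pat.
  rewrite -[RHS](flipK i (fun j => L0 c j c0) (fun j => Lg c j c0)).
  by rewrite {1 2}/flip; case: ifP => // _; rewrite tE.
Qed.
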